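(* Let $m\ge 1$ be an integer and let $G$ be a planar bipartite graph having property $( * )_m$. Then the poset $(\mathcal D_m(G),\le)$ of $m$-dimer covers of $G$, ordered by up-flips, is a distributive lattice.
   Context: **Planar bipartite graph.** A graph $G$ that is finite, connected, with a (fixed) planar embedding such that each bounded face is a disc, and with a proper coloring of its vertices by black and white. $V(G),E(G),F(G)$ denote its vertices, edges, and faces (including the unbounded face $f_\infty$). **$m$-dimer cover.** A multiset $M$ of edges of $G$ whose multiplicity function $\operatorname{mult}_M:E(G)\to\mathbb Z_{\ge0}$ satisfies $\sum_{e\ni v}\operatorname{mult}_M(e)=m$ for every $v\in V(G)$. The set of all of them is $\mathcal D_m(G)$. **Property $( * )_m$.** For every $e\in E(G)$ there are $m$-dimer covers $M_1,M_2$ of $G$ with $\operatorname{mult}_{M_1}(e)>0$ and $\operatorname{mult}_{M_2}(e)=0$. **Up-flip.** Let $f$ be a bounded face with boundary edges $e_1,\dots,e_{2n}$ listed and oriented clockwise, such that each $e_{2i}$ is oriented from white to black and each $e_{2i-1}$ from black to white. If $M\in\mathcal D_m(G)$ has $\operatorname{mult}_M(e_{2i})\ge1$ for all $i=1,\dots,n$, the up-flip of $M$ around $f$ is the $m$-dimer cover $M'$ with $\operatorname{mult}_{M'}(e_{2i-1})=\operatorname{mult}_M(e_{2i-1})+1$, $\operatorname{mult}_{M'}(e_{2i})=\operatorname{mult}_M(e_{2i})-1$, and the same multiplicity on all other edges; write $M\lessdot M'$. The order: $M\le M'$ if there is a (possibly empty) sequence of up-flips transforming $M$ into $M'$. *)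

(* Defs.v *)
From HB Require Import structures.
From mathcomp Require Import all_boot all_order all_fingroup.

Set Implicit Arguments.
Unset Strict Implicit.
Unset Printing Implicit Defensive.

(* Planar embeddings are encoded combinatorially, by a rotation system of     *)
(* genus 0 together with a distinguished face.  An edge e, whose endpoints    *)
(* are wend e (white) and bend e (black), has two orientations, or darts:     *)
(* (e, true) goes from white to black, (e, false) from black to white.        *)
(* Parallel edges are allowed; loops are excluded by the colouring.           *)
(* - rot maps a dart d to the dart that follows it counterclockwise around    *)
(*   its origin.                                                              *)
(* - If d = (u -> v), then rot (rev d) is the next dart of the boundary walk  *)
(*   that keeps on its right the face lying to the right of d.  A bounded     *)
(*   face is thus traversed clockwise, and a boundary edge e of f is oriented *)
(*   from white to black (resp. from black to white) by the clockwise         *)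
(*   traversal of f iff rface (e, true) = f (resp. rface (e, false) = f).     *)
(* - By construction a face is a disc glued along its boundary walk (and the  *)
(*   outer face is one with a point removed).  An edge or a vertex may occur  *)
(*   twice in a boundary walk.                                                *)
(* - The vertices and faces are types of their own, rather than orbits of     *)
(*   darts, so as to cover the graph with one vertex and no edge.             *)
Record plane_bigraph := PlaneBigraph {
  vertex : finType;
  edge : finType;
  face : finType;
  outer : face;
  white : pred vertex;
  wend : edge -> vertex;
  bend : edge -> vertex;
  rot : {perm edge * bool};
  rface : edge * bool -> face;
  origin := fun d : edge * bool => if d.2 then wend d.1 else bend d.1;
  rev := fun d : edge * bool => (d.1, ~~ d.2);
  adjacent := fun u v : vertex =>
    [exists d : edge * bool, (origin d == u) && (origin (rev d) == v)];
  white_wend : forall e, white (wend e);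
  black_bend : forall e, ~~ white (bend e);
  rotP : forall d d', (origin d == origin d') = fconnect rot d d';
  rfaceP : forall d d',
    (rface d == rface d') = fconnect (fun x => rot (rev x)) d d';
  rface_onto : forall (e : edge) (f : face), exists d, rface d = f;
  vertex_nonempty : 0 < #|vertex|;
  connected : forall u v, connect adjacent u v;
  euler : #|vertex| + #|face| = #|edge| + 2
}.

Arguments outer : clear implicits.
Arguments wend {p} _.
Arguments bend {p} _.
Arguments rface {p} _.

Section DimerCovers.
Variables (G : plane_bigraph) (m : nat).

Definition incident (v : vertex G) (e : edge G) : bool :=
  (v == wend e) || (v == bend e).

Definition is_dimer_cover (M : {ffun edge G -> nat}) : bool :=
  [forall v : vertex G, \sum_(e | incident v e) M e == m].

Definition dimer_cover : Type := {M : {ffun edge G -> nat} | is_dimer_cover M}.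

Definition mult (M : dimer_cover) (e : edge G) : nat := val M e.

Definition property_star : Prop :=
  forall e : edge G,
  exists M1 M2 : dimer_cover, 0 < mult M1 e /\ mult M2 e = 0.

Definition up_flip_at (f : face G) (M M' : dimer_cover) : bool :=
  [forall e, (rface (e, true) == f) ==> (1 <= mult M e)] &&
  [forall e,
    [&& (rface (e, false) == f) ==> (mult M' e == mult M e + 1),
        (rface (e, true) == f) ==> (mult M' e == mult M e - 1)
      & ((rface (e, false) != f) && (rface (e, true) != f)) ==>
          (mult M' e == mult M e)]].

Definition up_flip (M M' : dimer_cover) : bool :=
  [exists f, (f != outer G) && up_flip_at f M M'].

Definition flip_le (M M' : dimer_cover) : Prop :=
  exists2 s : seq dimer_cover, path up_flip M s & last M s = M'.

End DimerCovers.

(* le is the order of a distributive lattice carried by T, which may be      *)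
(* empty: the one-vertex graph vacuously satisfies property_star and has no   *)
(* m-dimer cover.                                                             *)
Definition is_distributive_lattice (T : Type) (le : T -> T -> Prop) : Prop :=
  exists (d : Order.disp_t) (c : Order.DistrLattice.axioms_ d T),
  forall x y : T, le x y <-> @Order.le d (Order.DistrLattice.Pack c) x y.

(* Main.v *)
From HB Require Import structures.
From mathcomp Require Import all_boot all_order all_fingroup all_algebra.
From mathcomp Require Import zify ring.
Require Import Defs.

(** Fix a dimer cover M0.  For another cover M, the difference M - M0 sums to 0
around every vertex, hence, the edges being oriented from white to black, it is
a circulation.  In genus 0 every circulation is the jump across edges of a
function on faces that is unique once it vanishes on the outer face: the height
of M (circulation_jump).  An up-flip around f adds 1 to the height of f and
changes nothing else (up_flip_height, height_up_flip).

The heights of covers are the integer functions h on faces, null on the outer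
face, with M0 e + jump h e >= 0 for every edge e.  Each of these conditions
bounds a difference of two values of h, so the set of solutions is closed under
pointwise minimum and maximum (height_min, height_max): with the pointwise
order it is a sublattice of a power of the chain of integers, thus a
distributive lattice (pointwise_sublattice_distributive).

It remains to see that flips generate the pointwise order (flip_le_height).
Let M lie strictly below M'.  By induction on the total difference of heights
it is enough to flip M up at one face where M is strictly lower than M'.  If a
face f with this property cannot be flipped up, some edge e with M e = 0 has f
on its right when directed from white to black; nonnegativity of M' e then
forces the face on the other side of e to be strictly lower for M as well.
Following such edges from face to face, one would eventually close a cycle of
the dual graph crossed by edges of multiplicity 0, all directed the same way.
The sum of multiplicities over such a cycle does not depend on the cover, so
these edges would be absent from every cover, against the hypothesis.  The
formal proof (flippable_face) replaces the cycle by a potential on faces that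
strictly increases across every edge absent from M.

The existence of heights is a dimension count with Euler's formula: the map
from face functions to edge functions has rank at least #faces - 1, since the
dual graph is connected; the map from edge functions to vertex functions has
rank at least #vertices - 1, since the graph is connected; the composite is 0,
and #edges = (#faces - 1) + (#vertices - 1).  So the image of the former is the
kernel of the latter over the rationals, and a rational height with integer
jumps that is 0 somewhere is an integer everywhere. *)

Import Order.TTheory GRing.Theory Num.Theory.

(** * Sublattices of powers of the integers *)

Section Sublattice.
Set Implicit Arguments.
Local Open Scope ring_scope.

(** The lattice identities hold coordinatewise in the integers, and injectivity
of f brings them back to T. *)
Lemma pointwise_sublattice_distributive (I : finType) (T : choiceType)
    (f : T -> {ffun I -> int}) :
    injective f ->
    (forall x y, exists z, forall i, f z i = Num.min (f x i) (f y i)) ->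
    (forall x y, exists z, forall i, f z i = Num.max (f x i) (f y i)) ->
  is_distributive_lattice (fun x y : T => forall i, f x i <= f y i).
Proof.
(* The structures are inferred on T only if it unfolds to an explicit record. *)
case: T f => T0 choiceT0; pose T : choiceType := Choice.Pack choiceT0.
rewrite -/T => f f_inj has_min has_max.
(* Both sides are finite functions into integers, so that being a meet is
   decidable and a meet can be chosen without any axiom. *)
have lattice_op (op : int -> int -> int) :
    (forall x y, exists z, forall i, f z i = op (f x i) (f y i)) ->
    {g : T -> T -> T | forall x y i, f (g x y) i = op (f x i) (f y i)}.
  move=> h; have h' x y : exists z, [forall i, f z i == op (f x i) (f y i)].
    by have [z hz] := h x y; exists z; apply/forallP=> i; rewrite hz.
  exists (fun x y => xchoose (h' x y)) => x y i.
  by apply/eqP; have /forallP := xchooseP (h' x y); apply.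
have [meet meetE] := lattice_op Num.min has_min.
have [join joinE] := lattice_op Num.max has_max.
pose le x y := [forall i, f x i <= f y i].
pose lt x y := (y != x) && le x y.
have ext x y : (forall i, f x i = f y i) -> x = y.
  by move=> h; apply: f_inj; apply/ffunP.
have le_def x y : le x y = (meet x y == x).
  apply/forallP/eqP => [le_xy | <- i]; last by rewrite meetE ge_min lexx orbT.
  by apply: ext => i; rewrite meetE min_l.
have lt_def x y : lt x y = (y != x) && le x y by [].
have meetC : commutative meet by move=> x y; apply: ext=> i; rewrite !meetE minC.
have joinC : commutative join by move=> x y; apply: ext=> i; rewrite !joinE maxC.
have meetA : associative meet by move=> x y z; apply: ext=> i; rewrite !meetE minA.
have joinA : associative join by move=> x y z; apply: ext=> i; rewrite !joinE maxA.
have joinKI y x : meet x (join x y) = x.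
  by apply: ext => i; rewrite meetE joinE; lia.
have meetKU y x : join x (meet x y) = x.
  by apply: ext => i; rewrite joinE meetE; lia.
have meetUl : left_distributive meet join.
  by move=> x y z; apply: ext=> i; rewrite !(meetE, joinE); lia.
have meetxx : idempotent_op meet by move=> x; apply: ext=> i; rewrite meetE minxx.
pose mixin := Order.isMeetJoinDistrLattice.Build (Order.Disp tt tt) T
  le_def lt_def meetC joinC meetA joinA joinKI meetKU meetUl meetxx.
pose L : distrLatticeType (Order.Disp tt tt) := HB.pack T mixin.
exists (Order.Disp tt tt), (Order.DistrLattice.class L) => x y.
by split=> [/forallP | /forallP].
Qed.

End Sublattice.

(** * Circulations on a plane graph are jumps of face functions *)

Section PlaneBigraph.
Set Implicit Arguments.
Local Open Scope ring_scope.
Variable G : plane_bigraph.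
Implicit Types (v : vertex G) (e : edge G) (f : face G).

(** Consecutive darts at a vertex bound a common angular sector: the face of
this sector is the right one for rot d and the left one for d. *)
Lemma rface_rot (d : edge G * bool) : rface (rot G d) = rface (rev d).
Proof.
apply/eqP; rewrite eq_sym rfaceP.
suff -> : rot G d = rot G (rev (rev d)) by apply: (fconnect1 (fun x => _ (rev x))).
by case: d => e b; rewrite /rev /= negbK.
Qed.

Lemma origin_rot (d : edge G * bool) : origin (rot G d) = origin d.
Proof. by apply/eqP; rewrite eq_sym rotP fconnect1. Qed.

Lemma vertex_invariant (Q : pred (vertex G)) :
  (forall e, Q (wend e) = Q (bend e)) -> forall u v, Q u = Q v.
Proof.
move=> Q_edge u v; have /connectP[p] := connected u v.
elim: p u => [|w p IHp] u /= => [_ -> // | /andP[/existsP[d /andP[/eqP<- /eqP<-]]]].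
move=> path_p last_p; rewrite -(IHp _ path_p last_p).
by case: d {path_p last_p} => e []; rewrite /origin /rev /= Q_edge.
Qed.

(** Connectedness of the dual graph.  The faces around a vertex are linked by
rface_rot, and the connectedness of the primal graph links the vertices.  With
no edge, Euler's formula leaves a single face. *)
Lemma face_invariant (Q : pred (face G)) :
    (forall e, Q (rface (e, true)) = Q (rface (e, false))) ->
  forall f g, Q f = Q g.
Proof.
move=> Q_edge.
have [e0 _ | noedge] := pickP (predT : pred (edge G)); last first.
  have card_edge : #|edge G| = 0%N by apply: eq_card0 => e; have := noedge e.
  have: (#|face G| <= 1)%N.
    by have := euler G; have := vertex_nonempty G; rewrite card_edge; lia.
  move=> /fintype_le1P face1 f g.
  by congr (Q _); apply: face1.
have Q_rev d : Q (rface (rev d)) = Q (rface d).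
  by case: d => e []; rewrite /rev /= Q_edge.
have Q_origin d d' : origin d = origin d' -> Q (rface d) = Q (rface d').
  move=> /eqP; rewrite rotP => /connectP[p].
  elim: p d => [|d1 p IHp] d /= => [_ -> // | /andP[/eqP<- path_p last_p]].
  by rewrite -(IHp _ path_p last_p) rface_rot Q_rev.
have Q_dart d d' : Q (rface d) = Q (rface d').
  have /connectP[p] := connected (origin d) (origin d').
  elim: p d => [|w p IHp] d /= => [_ eq_o | ]; first exact: Q_origin.
  move=> /andP[/existsP[c /andP[/eqP eq_dc /eqP eq_cw]]] path_p last_p.
  rewrite (Q_origin d c) // -Q_rev; apply: IHp; rewrite eq_cw //.
move=> f g; have [d <-] := rface_onto e0 f; have [d' <-] := rface_onto e0 g.
exact: Q_dart.
Qed.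

(** With the clockwise convention, the dart from white to black has rface (e, true)
on its right; the sign makes an up-flip at a face raise the height there. *)
Definition jump {V : zmodType} (h : face G -> V) e : V :=
  h (rface (e, false)) - h (rface (e, true)).

Lemma jump0_const (V : zmodType) (h : face G -> V) :
  (forall e, jump h e = 0) -> forall f g, h f = h g.
Proof.
move=> jump0 f g; apply/eqP.
rewrite (@face_invariant (fun f' => h f' == h g) _ f g) ?eqxx // => e.
by have /eqP := jump0 e; rewrite subr_eq0 => /eqP->.
Qed.

Lemma incident_wend v e : white v -> incident v e = (wend e == v).
Proof.
move=> white_v; rewrite /incident eq_sym; case: eqP => //= _.
by apply/negbTE/eqP => eq_v; have := black_bend e; rewrite -eq_v white_v.
Qed.

Lemma incident_bend v e : ~~ white v -> incident v e = (bend e == v).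
Proof.
move=> black_v; rewrite /incident orbC eq_sym; case: eqP => //= _.
by apply/negbTE/eqP => eq_v; have := white_wend e; rewrite -eq_v (negbTE black_v).
Qed.

(** Jumps are circulations: around a vertex they telescope, since reversing a
dart and rotating it lead to the same face.  The sign of the telescoping sum is
given by the colour of the vertex. *)
Lemma jump_sum0 (V : zmodType) (h : face G -> V) v :
  \sum_(e | incident v e) jump h e = 0.
Proof.
have dart_sum : \sum_(d | origin d == v) (h (rface (rev d)) - h (rface d)) = 0.
  rewrite sumrB [X in _ - X](reindex_inj (perm_inj (s := rot G))) /=.
  apply/eqP; rewrite subr_eq0; apply/eqP.
  by apply: eq_big => d; rewrite ?origin_rot ?rface_rot.
have [white_v | black_v] := boolP (white v).
  rewrite -[RHS]dart_sum; rewrite (eq_bigl _ _ (fun e => incident_wend v e white_v)).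
  rewrite (reindex_onto (fun e => (e, true)) fst) /=.
    by apply: eq_bigl => e; rewrite eqxx andbT.
  case=> e [] //= /eqP eq_v; move: (black_bend e).
  by rewrite /origin /= in eq_v; rewrite eq_v white_v.
apply: oppr_inj; rewrite oppr0 -[RHS]dart_sum -sumrN.
rewrite (eq_bigl _ _ (fun e => incident_bend v e black_v)).
rewrite [RHS](reindex_onto (fun e => (e, false)) fst) /=.
  by apply: eq_big => e; rewrite ?eqxx ?andbT // /jump opprB.
case=> e [] //= /eqP eq_v; move: (white_wend e).
by rewrite /origin /= in eq_v; rewrite eq_v (negbTE black_v).
Qed.

Definition jump_mx : 'M[rat]_(#|face G|, #|edge G|) :=
  \matrix_(i, j) jump (fun f => (f == enum_val i)%:R) (enum_val j).

Definition incidence_mx : 'M[rat]_(#|edge G|, #|vertex G|) :=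
  \matrix_(i, j) (incident (enum_val j) (enum_val i))%:R.

Lemma mul_jump_mx (h : 'rV[rat]_#|face G|) e :
  (h *m jump_mx) 0 (enum_rank e) = jump (fun f => h 0 (enum_rank f)) e.
Proof.
rewrite mxE /jump; under eq_bigr => i _ do rewrite mxE enum_rankK /jump mulrBr.
rewrite sumrB; congr (_ - _).
  rewrite (bigD1 (enum_rank (rface (e, false)))) //= enum_rankK eqxx mulr1.
  rewrite big1 ?addr0 // => i; rewrite -(inj_eq enum_val_inj) enum_rankK eq_sym.
  by move/negbTE->; rewrite mulr0.
rewrite (bigD1 (enum_rank (rface (e, true)))) //= enum_rankK eqxx mulr1.
rewrite big1 ?addr0 // => i; rewrite -(inj_eq enum_val_inj) enum_rankK eq_sym.
by move/negbTE->; rewrite mulr0.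
Qed.

Lemma mul_incidence_mx (D : 'rV[rat]_#|edge G|) v :
  (D *m incidence_mx) 0 (enum_rank v) =
  \sum_(e | incident v e) D 0 (enum_rank e).
Proof.
rewrite mxE [RHS]big_mkcond (reindex_onto enum_rank enum_val) /=; last first.
  by move=> i _; rewrite enum_valK.
apply: eq_big => [e | e _]; first by rewrite enum_rankK eqxx.
by rewrite mxE !enum_rankK; case: incident; rewrite ?mulr1 ?mulr0.
Qed.

Lemma jump_mx_incidence_mx : jump_mx *m incidence_mx = 0.
Proof.
apply/row_matrixP => i; rewrite row_mul row0; apply/rowP => j.
rewrite -[j]enum_valK mul_incidence_mx [RHS]mxE.
under eq_bigr => e _ do rewrite !mxE enum_rankK.
exact: jump_sum0.
Qed.

(** The kernel consists of the constant functions. *)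
Lemma rank_jump_mx : (#|face G| <= \rank jump_mx + 1)%N.
Proof.
have: (\rank (kermx jump_mx) <= 1)%N.
  apply: leq_trans (rank_leq_row (const_mx 1 : 'rV[rat]_#|face G|)).
  apply/mxrankS/row_subP => i.
  have := row_sub i (kermx jump_mx); move: (row i _) => h /sub_kermxP h0.
  have h_const := @jump0_const _ (fun f => h 0 (enum_rank f)) _ _ (outer G).
  have -> : h = h 0 (enum_rank (outer G)) *: const_mx 1.
    apply/rowP => j; rewrite !mxE mulr1 -[j]enum_valK; apply: h_const => e.
    by rewrite -mul_jump_mx h0 mxE.
  exact: scalemx_sub.
by rewrite mxrank_ker; lia.
Qed.

(** Together with a single vertex v0, the rows span everything: the row of an
edge is the sum of its endpoints, so that each endpoint is obtained from the
other. *)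
Lemma rank_incidence_mx : (#|vertex G| <= \rank incidence_mx + 1)%N.
Proof.
have /card_gt0P[v0 _] := vertex_nonempty G.
pose vx v : 'rV[rat]_#|vertex G| := delta_mx 0 (enum_rank v).
have row_incidence e : row (enum_rank e) incidence_mx = vx (wend e) + vx (bend e).
  apply/rowP => j; rewrite !mxE eqxx /= enum_rankK.
  rewrite -!(inj_eq enum_val_inj) !enum_rankK /incident.
  case: eqP => [-> | _] /=; case: eqP => //= eq_be; rewrite ?addr0 ?add0r //.
  by have := black_bend e; rewrite -eq_be white_wend.
have edge_sub e : ((vx (wend e) + vx (bend e))%R <= incidence_mx + vx v0)%MS.
  by rewrite -row_incidence (submx_trans (row_sub _ _)) ?addsmxSl.
have vx_sub v : (vx v <= incidence_mx + vx v0)%MS.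
  rewrite (@vertex_invariant (fun v => (vx v <= incidence_mx + vx v0)%MS) _ v v0).
    exact: addsmxSr.
  move=> e; apply/idP/idP => sub_e.
    by rewrite -[vx _](addKr (vx (wend e))) addmx_sub ?eqmx_opp.
  by rewrite -[vx _](addrK (vx (bend e))) addmx_sub ?eqmx_opp.
rewrite -[X in (X <= _)%N](mxrank1 rat).
apply: leq_trans (_ : \rank (incidence_mx + vx v0)%MS <= _)%N.
  apply/mxrankS/row_subP => i; rewrite row1 -[i]enum_valK; exact: vx_sub.
apply: leq_trans (mxrank_adds_leqif _ _).1 _.
by rewrite leq_add2l rank_leq_row.
Qed.

(** Exactness at the edges: by Euler's formula, the rank bounds leave no room
between the image of the jump map and the kernel of the incidence map. *)
Lemma circulation_jump_rat (D : edge G -> rat) :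
    (forall v, \sum_(e | incident v e) D e = 0) ->
  exists h : face G -> rat, D =1 jump h.
Proof.
move=> D_sum0; pose d : 'rV[rat]_#|edge G| := \row_i D (enum_val i).
have jump_ker : (jump_mx <= kermx incidence_mx)%MS.
  exact/sub_kermxP/jump_mx_incidence_mx.
have /eqmxP jump_eq_ker : (jump_mx == kermx incidence_mx)%MS.
  rewrite -(geq_leqif (mxrank_leqif_eq jump_ker)) mxrank_ker.
  by move: rank_jump_mx rank_incidence_mx (euler G); lia.
have: (d <= jump_mx)%MS.
  rewrite jump_eq_ker; apply/sub_kermxP/rowP => j.
  rewrite -[j]enum_valK mul_incidence_mx [RHS]mxE -[RHS](D_sum0 (enum_val j)).
  by apply: eq_bigr => e _; rewrite mxE enum_rankK.
case/submxP => h d_eq; exists (fun f => h 0 (enum_rank f)) => e.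
by rewrite -mul_jump_mx -d_eq mxE enum_rankK.
Qed.

(** Rational heights are integral, for integrality propagates from the outer
face across the edges. *)
Lemma circulation_jump (D : edge G -> int) :
    (forall v, \sum_(e | incident v e) D e = 0) ->
  exists h : face G -> int, h (outer G) = 0 /\ D =1 jump h.
Proof.
move=> D_sum0.
have [v | h hE] := @circulation_jump_rat (fun e => (D e)%:~R).
  by rewrite -(rmorph_sum (intr : {rmorphism int -> rat})) D_sum0.
pose h0 f : rat := h f - h (outer G).
have h0_int f : h0 f \is a Num.int.
  rewrite (@face_invariant (fun f => h0 f \is a Num.int) _ f (outer G)).
    by rewrite /h0 subrr.
  move=> e; have -> : h0 (rface (e, false)) = h0 (rface (e, true)) + (D e)%:~R.
    by rewrite hE /jump /h0; ring.
  by rewrite [RHS]rpredDr ?intr_int.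
exists (fun f => Num.floor (h0 f)); split; first by rewrite /h0 subrr floor0.
move=> e; apply: (@intr_inj rat); rewrite rmorphB /= !floorK // hE /jump /h0.
by ring.
Qed.

End PlaneBigraph.

Arguments jump {G V} h e : rename.

(** * Heights of dimer covers *)

Section DimerHeights.
Set Implicit Arguments.
Local Open Scope ring_scope.
Variables (G : plane_bigraph) (m : nat).
Local Notation cover := {M : {ffun edge G -> nat} | is_dimer_cover m M}.
Implicit Types (v : vertex G) (e : edge G) (f g : face G).

Lemma mult_sum (M : dimer_cover G m) v : (\sum_(e | incident v e) mult M e = m)%N.
Proof. by apply/eqP; have /forallP := valP M; apply. Qed.

Lemma mult_inj (M M' : dimer_cover G m) : mult M =1 mult M' -> M = M'.
Proof. by move=> eqM; apply/val_inj/ffunP. Qed.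

Variable M0 : cover.
Implicit Types M : cover.

Lemma height_subproof M : exists h : {ffun face G -> int},
  (h (outer G) == 0) && [forall e, (mult M e)%:Z == (mult M0 e)%:Z + jump h e].
Proof.
have [v | h [h0 hE]] :=
  @circulation_jump G (fun e => (mult M e)%:Z - (mult M0 e)%:Z).
  by rewrite sumrB -!(big_morph Posz PoszD erefl) !mult_sum subrr.
exists (finfun h); rewrite ffunE h0 eqxx; apply/forallP => e; apply/eqP.
by rewrite /jump !ffunE -/(jump h e) -hE addrC subrK.
Qed.

Definition height M : {ffun face G -> int} := xchoose (height_subproof M).

Lemma height_outer M : height M (outer G) = 0.
Proof. by apply/eqP; have /andP[] := xchooseP (height_subproof M). Qed.

Lemma mult_height M e : (mult M e)%:Z = (mult M0 e)%:Z + jump (height M) e.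
Proof.
by have /andP[_ /forallP/(_ e)/eqP] := xchooseP (height_subproof M).
Qed.

Lemma height_unique M (h : face G -> int) :
    h (outer G) = 0 -> (forall e, (mult M e)%:Z = (mult M0 e)%:Z + jump h e) ->
  height M =1 h.
Proof.
move=> h0 hE f; apply/eqP; rewrite -subr_eq0; apply/eqP.
rewrite (@jump0_const _ _ (fun f => height M f - h f) _ _ (outer G)).
  by rewrite height_outer h0 subrr.
by move=> e; have := hE e; rewrite mult_height /jump; lia.
Qed.

Lemma height_inj : injective height.
Proof.
move=> M M' eq_h; apply: mult_inj => e.
by apply/eqP; rewrite -eqz_nat (mult_height M) (mult_height M') eq_h.
Qed.

(** The only condition on the height of a cover is that multiplicities be
nonnegative: the sums around vertices are those of M0 by jump_sum0. *)
Lemma height_surj (h : face G -> int) :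
    h (outer G) = 0 -> (forall e, 0 <= (mult M0 e)%:Z + jump h e) ->
  exists M, height M =1 h.
Proof.
move=> h0 h_ge0.
pose N := [ffun e => absz ((mult M0 e)%:Z + jump h e)].
have NE e : (N e)%:Z = (mult M0 e)%:Z + jump h e by rewrite ffunE gez0_abs.
have N_cover : is_dimer_cover m N.
  apply/forallP => v; rewrite -eqz_nat -(mult_sum M0 v).
  rewrite !(big_morph Posz PoszD erefl).
  under eq_bigr => e _ do rewrite NE.
  by rewrite big_split /= jump_sum0 addr0.
by exists (exist _ N N_cover); apply: height_unique.
Qed.

(** If the minimum at rface (e, false) is attained by M, then the jump of the
minimum at e is at least that of M; likewise for M'.  For the maximum, the same
holds with rface (e, true). *)
Lemma height_min M M' : exists L, forall f,
  height L f = Num.min (height M f) (height M' f).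
Proof.
apply: height_surj => [|e]; first by rewrite !height_outer.
by have := (mult_height M e); have := mult_height M' e; rewrite /jump; lia.
Qed.

Lemma height_max M M' : exists L, forall f,
  height L f = Num.max (height M f) (height M' f).
Proof.
apply: height_surj => [|e]; first by rewrite !height_outer.
by have := (mult_height M e); have := mult_height M' e; rewrite /jump; lia.
Qed.

(** The function equal to 1 at f and 0 elsewhere has jump 1 on the edges to be
increased and -1 on those to be decreased.  An edge with f on both sides would
have to be both increased and decreased, so that no up-flip exists at f. *)
Lemma up_flip_height M M' :
  up_flip M M' -> exists f, forall g, height M' g = height M g + (g == f)%:R.
Proof.
case/existsP => f /andP[f_bounded /andP[/forallP flippable /forallP flipped]].
exists f; apply: height_unique => [|e].
  by rewrite height_outer eq_sym (negbTE f_bounded).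
have := mult_height M e; have := flippable e; have /and3P[] := flipped e.
rewrite /jump; case: (_ == f); case: (_ == f); lia.
Qed.

Hypothesis star : property_star G m.

(** Across an edge with the same face on both sides heights do not jump, so it
would have the same multiplicity in all covers. *)
Lemma rface_neq e : rface (e, true) != rface (e, false).
Proof.
apply/eqP => same_face; have [M1 [M2 [M1_pos M2_0]]] := star e.
by have := mult_height M1 e; have := mult_height M2 e; rewrite /jump same_face; lia.
Qed.

(** The converse of up_flip_height rests on rface_neq: around a face that lies on
both sides of an edge, the heights could be raised although no flip exists. *)
Lemma height_up_flip M M' f :
    f != outer G -> (forall g, height M' g = height M g + (g == f)%:R) ->
  up_flip M M'.
Proof.
move=> f_bounded hE; apply/existsP; exists f; rewrite f_bounded /=.
have multE e : (mult M' e)%:Z = (mult M e)%:Z + (rface (e, false) == f)%:R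
                                              - (rface (e, true) == f)%:R.
  by have := mult_height M e; have := mult_height M' e; rewrite /jump !hE; lia.
have sides e : ~~ ((rface (e, true) == f) && (rface (e, false) == f)).
  by apply/negP => /andP[/eqP eq_f]; rewrite -eq_f eq_sym (negbTE (rface_neq e)).
apply/andP; split; apply/forallP => e; have := multE e; have := sides e.
  by case: (_ == f); case: (_ == f); lia.
by case: (_ == f); case: (_ == f); lia.
Qed.

(** The key step: a face maximizing the potential p among those where M is
strictly lower can be flipped up.  Here p sums, over the edges e, the height
relative to M of a cover N e that contains e; across an edge absent from M every
term is nondecreasing and the one of the edge itself increases.  An obstructing
edge at the maximal face would thus lead to another admissible face with a
larger potential. *)
Lemma flippable_face M M' f0 :
    (forall f, height M f <= height M' f) -> height M f0 < height M' f0 ->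
  exists f, height M f < height M' f
    /\ forall e, rface (e, true) = f -> (0 < mult M e)%N.
Proof.
move=> le_h lt_f0.
have has_pos e : exists N : cover, (0 < mult N e)%N.
  by have [N [_ [? _]]] := star e; exists N.
pose N e := xchoose (has_pos e).
pose p f := \sum_e (height (N e) f - height M f).
have p_incr e : mult M e = 0%N -> p (rface (e, true)) < p (rface (e, false)).
  move=> Me0; rewrite -subr_gt0 -sumrB (bigD1 e) //=.
  have N_pos : (0 < mult (N e) e)%N := xchooseP (has_pos e).
  have step e' : height (N e') (rface (e, false)) - height M (rface (e, false))
      - (height (N e') (rface (e, true)) - height M (rface (e, true)))
      = (mult (N e') e)%:Z.
    by have := mult_height M e; have := mult_height (N e') e; rewrite /jump; lia.
  rewrite step ltr_pwDl ?ltz_nat // sumr_ge0 // => e' _.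
  by rewrite step.
have [f lt_f f_max] :=
  @arg_maxP _ _ _ f0 (fun f => height M f < height M' f) p lt_f0.
exists f; split=> // e eq_f; rewrite lt0n; apply/eqP => Me0.
have := p_incr e Me0; rewrite ltNge => /negP; apply; rewrite eq_f; apply: f_max.
have := mult_height M e; have := mult_height M' e; rewrite /jump eq_f.
by move: lt_f; lia.
Qed.

(** From the pointwise order to flips, the induction is on the sum over faces of
the differences of heights, which a flip decreases by one. *)
Lemma flip_le_height (M M' : cover) :
  flip_le M M' <-> forall f, height M f <= height M' f.
Proof.
split=> [[s path_s last_s] f | ].
  elim: s M path_s last_s => [|M1 s IHs] M /= => [_ -> // | /andP[flip_M path_s] last_s].
  have [f' flipE] := up_flip_height _ _ flip_M.
  by apply: le_trans (IHs _ path_s last_s); rewrite flipE; lia.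
have [n] := ubnP (\sum_f `|height M' f - height M f|)%N.
elim: n M => // n IHn M dist_lt le_h.
have [/forallP eq_h | ] := boolP [forall f, height M f == height M' f].
  by exists [::] => //=; apply/height_inj/ffunP => f; apply/eqP.
rewrite negb_forall => /existsP[f0 ne_f0].
have [f [lt_f flippable]] : exists f, height M f < height M' f
    /\ forall e, rface (e, true) = f -> (0 < mult M e)%N.
  by apply: (@flippable_face M M' f0) => //; rewrite lt_neqAle ne_f0 le_h.
have f_bounded : f != outer G.
  by apply: contraTneq lt_f => ->; rewrite !height_outer.
have [|e|M1 M1E] := @height_surj (fun g => height M g + (g == f)%:R).
- by rewrite height_outer eq_sym (negbTE f_bounded).
- have := mult_height M e; have := flippable e; rewrite /jump.
  by case: (rface (e, false) == f); case: eqP => [eq_f /(_ eq_f) | _ _]; lia.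
have flip_M : up_flip M M1 by exact: height_up_flip f_bounded M1E.
have le_h1 g : height M1 g <= height M' g.
  by rewrite M1E; have := le_h g; case: eqP => [->|_]; lia.
have [|s path_s last_s] := IHn M1 _ le_h1; last first.
  by exists (M1 :: s); rewrite //= flip_M.
rewrite ltnS in dist_lt; apply: leq_trans dist_lt.
rewrite (bigD1 f) //= [in X in (_ < X)%N](bigD1 f) //=.
rewrite -addSn leq_add //; first by rewrite M1E eqxx; lia.
by apply: leq_sum => g /negbTE ne_g; rewrite M1E ne_g addr0.
Qed.

End DimerHeights.

Arguments height {G m} M0 M.
Arguments flip_le_height {G m} M0 star M M'.

Theorem theorem2p17 (G : plane_bigraph) (m : nat) (hm : 1 <= m)
  (hG : property_star G m) :
  is_distributive_lattice (@flip_le G m).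
Proof.
pose cover := {M : {ffun edge G -> nat} | is_dimer_cover m M}.
(* Heights need a reference cover; without any, all is vacuous. *)
suff [M0 | no_cover] : cover + (cover -> False).
- have [d [c leE]] : is_distributive_lattice
    (fun M M' : cover => forall f, (height M0 M f <= height M0 M' f)%R).
    apply: pointwise_sublattice_distributive.
    + exact: height_inj.
    + exact: height_min.
    + exact: height_max.
  by exists d, c => M M'; rewrite (flip_le_height M0) //; exact: leE.
- pose no_height (M : cover) : {ffun void -> int} := [ffun=> 0%R].
  have [d [c leE]] : is_distributive_lattice
    (fun M M' : cover => forall i, (no_height M i <= no_height M' i)%R).
    apply: pointwise_sublattice_distributive.
    + by move=> M.
    + by move=> M.
    + by move=> M.
  by exists d, c.
(* With an edge, the hypothesis provides a cover; without any, the sum around a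
   vertex is 0, not m. *)
have [e _ | no_edge] := pickP (predT : pred (edge G)).
  suff /sigW[M _] : exists M : cover, 0 < mult M e by left.
  by have [M [_ [? _]]] := hG e; exists M.
right=> M; have /card_gt0P[v _] := vertex_nonempty G.
have := mult_sum M v; rewrite big1 => [m0 | e _]; first by rewrite -m0 in hm.
by have := no_edge e.
Qed.
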